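(* Let $g:[0,\infty)\to[0,\infty)$ be concave and non-decreasing with $g(0)=0$. For online single-machine preemptive scheduling, HDF (at every time process at full rate a pending job of maximum density $w_j/p_j$) is, for every $\epsilon>0$, $(1+\epsilon)$-speed $\frac{1+\epsilon}{\epsilon}$-competitive for the integral objective $\sum_j w_j g(C_j-r_j)$.
   Context: Job $j$ has release time $r_j\ge0$, processing time $p_j>0$, weight $w_j>0$, revealed at $r_j$. A schedule of speed $s$ assigns rates $x_j(t)\ge0$, $x_j(t)=0$ for $t<r_j$, $\sum_j x_j(t)\le s$; $C_j$ is the first time with $\int_{r_j}^{C_j}x_j=p_j$. An online algorithm (speed 1) is $\alpha$-speed $\beta$-competitive if its cost is at most $\beta$ times the minimum cost over offline schedules of speed $1/\alpha$. *)

(* Defs.v *)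
From HB Require Import structures.
From mathcomp Require Import all_boot all_order all_algebra.
From mathcomp Require Import all_classical all_reals all_analysis.

Set Implicit Arguments.
Unset Strict Implicit.
Unset Printing Implicit Defensive.

Import Order.TTheory GRing.Theory Num.Theory.
Import numFieldNormedType.Exports.

Local Open Scope classical_set_scope.
Local Open Scope ring_scope.

Record instance (R : realType) := Instance {
  njobs : nat;
  release : 'I_njobs -> R;
  proctime : 'I_njobs -> R;
  weight : 'I_njobs -> R;
  release_ge0 : forall j, 0 <= release j;
  proctime_gt0 : forall j, 0 < proctime j;
  weight_gt0 : forall j, 0 < weight j }.

Definition job (R : realType) (I : instance R) : Type := 'I_(njobs I).

Definition density (R : realType) (I : instance R) (j : job I) : R :=
  weight j / proctime j.

(* [x j t] is the rate at which job [j] is processed at time [t]. *)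
Definition rates (R : realType) (I : instance R) : Type := job I -> R -> R.

Definition is_schedule (R : realType) (I : instance R) (s : R)
    (x : rates I) : Prop :=
  [/\ forall j, measurable_fun [set: R] (x j),
      forall j t, 0 <= x j t,
      forall j t, t < release j -> x j t = 0 &
      forall t, \sum_(j < njobs I) x j t <= s].

Definition work (R : realType) (I : instance R) (x : rates I) (j : job I)
    (t : R) : \bar R :=
  (\int[lebesgue_measure]_(u in `[release j, t]) (x j u)%:E)%E.

(* [C j] is the first time at which job [j] has received [proctime j] units of
   processing; in particular every job is eventually completed. *)
Definition completion_times (R : realType) (I : instance R) (x : rates I)
    (C : job I -> R) : Prop :=
  forall j, work x j (C j) = (proctime j)%:E /\
            forall c, work x j c = (proctime j)%:E -> C j <= c.

Definition cost (R : realType) (g : R -> R) (I : instance R)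
    (C : job I -> R) : R :=
  \sum_(j < njobs I) weight j * g (C j - release j).

(* Optimal offline cost at speed [s], as an infimum in the extended reals: it
   coincides with the minimum whenever the latter is attained. *)
Definition opt_cost (R : realType) (g : R -> R) (I : instance R) (s : R) :
    \bar R :=
  ereal_inf [set v | exists x : rates I, exists C : job I -> R,
    [/\ is_schedule s x, completion_times x C & v = (cost g C)%:E]].

Definition algorithm (R : realType) : Type := forall I : instance R, rates I.

Definition competitive (R : realType) (g : R -> R) (A : algorithm R)
    (alpha beta : R) : Prop :=
  forall I : instance R, is_schedule 1 (A I) /\
    exists C : job I -> R, completion_times (A I) C /\
      ((cost g C)%:E <= beta%:E * opt_cost g I alpha^-1)%E.

Definition pending (R : realType) (I : instance R) (x : rates I) (t : R)
    (j : job I) : Prop :=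
  release j <= t /\ (work x j t < (proctime j)%:E)%E.

(* The rule at time [t] involves only jobs released by [t] and the processing
   they received so far.  Ties between jobs of maximum density may be broken
   arbitrarily, possibly differently at different times. *)
Definition is_HDF (R : realType) (A : algorithm R) : Prop :=
  forall I : instance R, is_schedule 1 (A I) /\
    forall t : R, (exists j, pending (A I) t j) ->
      exists i, [/\ pending (A I) t i,
        forall j, pending (A I) t j -> density j <= density i &
        A I i t = 1].

(* [R^o] is [R] seen as a module over itself. *)
Definition concave_function (R : realType) (D : set R) (g : R -> R) : Prop :=
  @convex_function R R^o D (fun u => - g u).

(* Main.v *)
(* Integrating over density thresholds (Abel summation) reduces the claim to
   the jobs of density at least [th], all weighted by their processing times:
   restricted to these jobs, HDF is just some schedule that never idles while
   one of them is pending.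

   For such a schedule let [beta t] be the first idle time after [t].  By
   subadditivity of [g], the prices [lam j = g (beta r_j - r_j)] and
   [gam t = g (beta t - t)] satisfy [lam j <= g (t - r_j) + gam t] for
   [t >= r_j], so a schedule of speed [s] costs at least
   [\sum_j p_j lam j - s * \int gam].  Work is released before it is processed,
   hence [\int gam <= \sum_j p_j lam j], and the lower bound is at least
   [(1 - s) \sum_j p_j lam j], where [lam j >= g (C_j - r_j)]. *)
Require Import Defs.
From HB Require Import structures.
From mathcomp Require Import all_boot all_order all_algebra.
From mathcomp Require Import all_classical all_reals all_analysis.
From mathcomp Require Import measurable_realfun ring lra.

Set Implicit Arguments.
Unset Strict Implicit.
Unset Printing Implicit Defensive.

Import Order.TTheory GRing.Theory Num.Theory.
Import numFieldNormedType.Exports.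
Local Open Scope classical_set_scope.
Local Open Scope ring_scope.

(** * Density thresholds and subadditivity of concave functions *)

(* Induction on the number of positive [d a]: subtract the least of them. *)
Lemma threshold_sum_ge0 (R : realType) (T : finType) (d c : T -> R) :
  (forall a, 0 <= d a) ->
  (forall th, 0 < th -> 0 <= \sum_(a | th <= d a) c a) ->
  0 <= \sum_a d a * c a.
Proof.
move en : #|[pred a | 0 < d a]| => n.
elim/ltn_ind: n d en => n IH d en d0 dc.
case: (pickP [pred a | 0 < d a]) => [a0 /= da0|dN]; last first.
  rewrite big1// => a _; have := dN a; rewrite /= => /negbT.
  rewrite -leNgt => da; have -> : d a = 0 by apply/eqP; rewrite eq_le da d0.
  by rewrite mul0r.
pose b := [arg min_(i < a0 | 0 < d i) d i]%O.
have [db bmin] : 0 < d b /\ forall a, 0 < d a -> d b <= d a.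
  by rewrite /b; case: arg_minP => // i di imin; split.
pose d' a := Num.max (d a - d b) 0.
have d'E a : d a * c a = d b * (if d b <= d a then c a else 0) + d' a * c a.
  rewrite /d'; case: ifPn => [dba|].
    by rewrite max_l ?subr_ge0// -mulrDl addrC subrK.
  rewrite -ltNge => dab; rewrite max_r; last by rewrite subr_le0 ltW.
  have [/bmin|da] := ltP 0 (d a); first by rewrite leNgt dab.
  have -> : d a = 0 by apply/eqP; rewrite eq_le da d0.
  by rewrite mulr0 !mul0r addr0.
rewrite (eq_bigr _ (fun a _ => d'E a)) big_split/= -mulr_sumr -big_mkcond/=.
apply: addr_ge0; first by rewrite mulr_ge0 ?dc ?ltW.
apply: (IH _ _ d' erefl).
- rewrite -en; apply: proper_card; apply/properP; split.
    apply/fintype.subsetP => a; rewrite !inE /d' lt_max ltxx orbF subr_gt0.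
    exact: lt_trans.
  by exists b; rewrite !inE// /d' subrr maxxx ltxx.
- by move=> a; rewrite /d' le_max lexx orbT.
(* For [th > 0] the truncation at 0 is invisible: the level set of [d'] at [th] is that of [d] at
   [th + d b]. *)
move=> th th0; have := dc (th + d b) (addr_gt0 th0 db).
congr (_ <= _); apply: eq_bigl => a.
by rewrite /d' le_max [th <= 0]leNgt th0 orbF lerBrDr.
Qed.

(** The graph lies above the chord from 0 to [u + v], so [g a >= a / (u + v) * g (u + v)]; adding
    the cases [a = u] and [a = v] gives the bound. *)
Lemma concave_subadditive (R : realType) (g : R -> R) (u v : R) :
  concave_function `[0, +oo[ g -> g 0 = 0 -> 0 <= u -> 0 <= v ->
  g (u + v) <= g u + g v.
Proof.
move=> gc g0 u0 v0.
have [uv0|uvN0] := eqVneq (u + v) 0.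
  have -> : u = 0 by lra.
  have -> : v = 0 by lra.
  by rewrite addr0 g0 addr0.
have uv0 : 0 < u + v by rewrite lt_neqAle eq_sym uvN0 addr_ge0.
have chord a b : 0 <= a -> 0 <= b -> a + b = u + v ->
    a / (u + v) * g (u + v) <= g a.
  move=> a0 b0 ab.
  have t0 : 0 <= a / (u + v) by rewrite divr_ge0// ltW.
  have t1 : a / (u + v) <= 1 by rewrite ler_pdivrMr// mul1r -ab lerDl.
  have t01 : Itv.spec (@Itv.num_sem R) (Itv.Real `[0%Z, 1%Z]) (a / (u + v)).
    by rewrite /Itv.spec /= /Itv.num_sem /= num_real/= in_itv/= t0 t1.
  have := gc (Itv.mk t01) (u + v) 0.
  rewrite !inE /= !in_itv/= !andbT (ltW uv0) lexx => /(_ isT isT).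
  have -> : conv (Itv.mk t01) (u + v : convex_lmodType R^o) 0 = a.
    by rewrite [LHS]convRE/= mulr0 addr0 divfK.
  by rewrite convRE/= g0 oppr0 mulr0 addr0 mulrN lerN2.
have := lerD (chord u v u0 v0 erefl) (chord v u v0 u0 (addrC _ _)).
by rewrite -mulrDl -mulrDl divff// mul1r.
Qed.

(** * Work received by a job as a function of time *)

Lemma rate_le (R : realType) (I : instance R) (s : R) (x : rates I)
  (j : job I) (t : R) : is_schedule s x -> x j t <= s.
Proof.
move=> [_ x0 _ xs]; apply: le_trans (xs t).
by rewrite (bigD1 j)//= lerDl sumr_ge0.
Qed.

Lemma work_homo (R : realType) (I : instance R) (s : R) (x : rates I)
  (j : job I) (t u : R) : is_schedule s x -> t <= u ->
  (work x j t <= work x j u)%E.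
Proof.
move=> [mx x0 _ _] tu; apply: ge0_subset_integral => //.
- by apply/measurable_EFinP; apply: measurable_funS (mx j).
- by move=> v _; rewrite lee_fin.
- by apply: subset_itvl; rewrite bnd_simp.
Qed.

Lemma work_lipschitz (R : realType) (I : instance R) (s : R) (x : rates I)
  (j : job I) (t u : R) : is_schedule s x -> t <= u ->
  (work x j u <= work x j t + (s * (u - t))%:E)%E.
Proof.
move=> xs tu; have [mx x0 _ _] := xs.
have mxj A : measurable_fun A (EFin \o x j).
  by apply/measurable_EFinP; apply: measurable_funS (mx j).
have xj0 v : (0 <= (EFin \o x j) v)%E by rewrite lee_fin.
have -> : (s * (u - t))%:E = (\int[lebesgue_measure]_(v in `]t, u]) (cst s%:E) v)%E.
  rewrite integral_cst//=.
  rewrite lebesgue_measure_itv/= lte_fin EFinM.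
  case: ltP tu => // tu ut; have -> : u = t by apply: le_anti; rewrite tu.
  by rewrite subrr mule0.
apply: (@le_trans _ _ (\int[lebesgue_measure]_(v in `[release j, t] `|` `]t, u])
    (EFin \o x j) v)%E).
  apply: ge0_subset_integral;
    [by []|exact: measurableU|exact: mxj|by move=> v _; exact: xj0|].
  move=> v /=; rewrite !in_itv/= => /andP[rv vu].
  by have [vt|vt] := leP v t; [left|right]; rewrite /= ?rv.
rewrite (ge0_integral_setU lebesgue_measure) => //; [|exact: mxj|].
  apply: leeD => //; apply: ge0_le_integral; [by []|by move=> v _|exact: mxj|by []|].
  by move=> v _; rewrite lee_fin; exact: rate_le xs.
apply/disj_setPS => v /= []; rewrite !in_itv/= => /andP[_ vt] /andP[tv _].
by move: (lt_le_trans tv vt); rewrite ltxx.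
Qed.

Lemma work_le_release (R : realType) (I : instance R) (x : rates I)
  (j : job I) (t : R) : t <= release j -> work x j t = 0%E.
Proof.
rewrite le_eqVlt /work => /orP[/eqP->|tr]; first by rewrite set_itv1 integral_set1.
by rewrite set_itv_ge ?integral_set0// bnd_simp -ltNge.
Qed.

Lemma work_fin_num (R : realType) (I : instance R) (s : R) (x : rates I)
  (j : job I) (t : R) : is_schedule s x -> work x j t \is a fin_num.
Proof.
move=> xs; have [_ x0 _ _] := xs.
have w0 : (0 <= work x j t)%E by apply: integral_ge0 => v _; rewrite lee_fin.
rewrite ge0_fin_numE//; have [/(work_le_release x)->//|/ltW rt] := leP t (release j).
apply: le_lt_trans (work_lipschitz j xs rt) _.
by rewrite work_le_release// add0e ltry.
Qed.

(** Work is non-decreasing and [s]-Lipschitz, so it takes the value [proctime j] exactly at the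
    infimum of the times where it has reached that value. *)
Lemma first_completion (R : realType) (I : instance R) (s : R) (x : rates I)
  (j : job I) (T : R) : is_schedule s x -> ((proctime j)%:E <= work x j T)%E ->
  exists c, [/\ c <= T, work x j c = (proctime j)%:E &
    forall c', work x j c' = (proctime j)%:E -> c <= c'].
Proof.
move=> xs pT; have p0 := proctime_gt0 j; set p := proctime j in p0 pT *.
pose f t := fine (work x j t).
have fE t : work x j t = (f t)%:E by rewrite /f fineK//; exact: work_fin_num xs.
have fh t u : t <= u -> f t <= f u.
  by move=> tu; rewrite -lee_fin -!fE; exact: work_homo xs tu.
have fl t u : t <= u -> f u <= f t + s * (u - t).
  by move=> tu; rewrite -lee_fin EFinD -!fE; exact: work_lipschitz xs tu.
have fr t : t <= release j -> f t = 0.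
  by move=> tr; rewrite /f work_le_release.
have s0 : 0 <= s by apply: le_trans (rate_le j 0 xs); case: xs => _ /(_ j 0).
pose S := [set t | p <= f t].
have ST : S T by rewrite /S/= -lee_fin -fE.
have Sr t : S t -> release j < t.
  by rewrite /S/= ltNge => pf; apply/negP => /fr ft; rewrite ft leNgt p0 in pf.
have Slb : has_lbound S by exists (release j) => t /Sr/ltW.
have cS t : S t -> inf S <= t by move=> St; exact: ge_inf.
have fc : f (inf S) = p.
  (* Over a time span [e / (s + 1)] the work grows by at most [e]; the [+ 1] keeps the divisor
     positive when [s = 0]. *)
  have e0 e : 0 < e -> 0 < e / (s + 1) by move=> e0; rewrite divr_gt0// ltr_wpDl.
  have es e : 0 < e -> s * (e / (s + 1)) <= e.
    by move=> e1; rewrite mulrCA ger_pMr// ler_pdivrMr ?ltr_wpDl// mul1r lerDl.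
  apply/eqP; rewrite eq_le !leNgt; apply/andP; split; apply/negP => h.
    (* With an excess at [inf S], a slightly earlier time would still lie in [S]. *)
    have d0 : 0 < f (inf S) - p by rewrite subr_gt0.
    have := e0 _ d0; have := es _ d0; set e := _ / (s + 1) => se e1.
    have := fl (inf S - e) (inf S); rewrite gerBl subKr (ltW e1) => /(_ isT) fe.
    have /cS : S (inf S - e) by rewrite /S/=; lra.
    by lra.
  (* Half the deficit is used so that a point of [S] this close to [inf S] would have work strictly
     below [p]. *)
  have d0 : 0 < (p - f (inf S)) / 2 by rewrite divr_gt0// subr_gt0.
  have [|t St tlt] := @inf_adherent _ S _ (e0 _ d0); first by split => //; exists T.
  have := fl _ _ (cS _ St); have pf : p <= f t by [].
  have := es _ d0; have : s * (t - inf S) <= s * ((p - f (inf S)) / 2 / (s + 1)).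
    by rewrite ler_wpM2l// lerBlDl ltW.
  by move=> *; lra.
exists (inf S); split; first exact: cS.
  by rewrite fE fc.
by move=> c'; rewrite fE => -[pc']; apply: cS; rewrite /S/= pc'.
Qed.

(** Integrating over the whole line lets the works of different jobs, each on its own interval, be
    summed under one integral. *)
Lemma work_indicator (R : realType) (I : instance R) (x : rates I)
  (j : job I) (t : R) : work x j t =
  (\int[lebesgue_measure]_u (x j u * \1_(`[release j, t]) u)%:E)%E.
Proof.
rewrite /work integral_mkcond; apply: eq_integral => u _; rewrite patchE indicE.
by case: ifPn => _; rewrite ?mulr1 ?mulr0.
Qed.

Lemma measurable_rate_indicator (R : realType) (I : instance R) (s : R)
  (x : rates I) (j : job I) (t : R) (A : set R) : is_schedule s x ->
  measurable A ->
  measurable_fun A (fun u => (x j u * \1_(`[release j, t]) u)%:E).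
Proof.
move=> [mx _ _ _] mA; apply/measurable_EFinP; apply: measurable_funM.
  exact: measurable_funS (mx j).
exact: measurable_indic.
Qed.

Lemma release_le_completion (R : realType) (I : instance R) (x : rates I)
  (C : job I -> R) (j : job I) : completion_times x C -> release j <= C j.
Proof.
move=> xC; rewrite leNgt; apply/negP => /ltW/(work_le_release x).
by case: (xC j) => -> _ [] /eqP; rewrite gt_eqF ?proctime_gt0.
Qed.

Lemma pending_completionP (R : realType) (I : instance R) (s : R) (x : rates I)
  (C : job I -> R) (t : R) (j : job I) : is_schedule s x -> completion_times x C ->
  pending x t j <-> release j <= t < C j.
Proof.
move=> xs xC; have [wC Cmin] := xC j; rewrite /pending; split.
  move=> [-> wt]; rewrite ltNge; apply/negP => /(work_homo j xs).
  by rewrite wC leNgt wt.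
move=> /andP[rt tC]; split=> //; rewrite lt_neqAle.
have := work_homo j xs (ltW tC); rewrite wC => ->; rewrite andbT.
by apply/eqP => /Cmin; rewrite leNgt tC.
Qed.

(** * Lower bound by dual prices for one density threshold *)

(** Weak linear programming duality with dual variables [lam] and [gam]. [J] stands for the jobs
    above a threshold; the order in which [x] serves them is left open. *)
Lemma work_conserving_bound (R : realType) (I : instance R) (J : pred (job I))
  (x y : rates I) (C D : job I -> R) (s : R) (G : R -> R) :
  is_schedule 1 x -> completion_times x C ->
  is_schedule s y -> completion_times y D -> 0 <= s ->
  (forall t, (exists j, [/\ J j, release j <= t & t < C j]) ->
    exists i, [/\ J i, release i <= t, t <= C i & x i t = 1]) ->
  (forall u, 0 <= G u) -> {homo G : u v / u <= v} ->
  (forall u v, G (u + v) <= G u + G v) -> G 0 = 0 -> s <= 1 ->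
  (1 - s) * \sum_(a | J a) proctime a * G (C a - release a) <=
  \sum_(a | J a) proctime a * G (D a - release a).
Proof.
move=> xs xC ys yD s0 busy G0 Gh Gsub Gz s1.
pose idle u := forall j, J j -> release j <= u -> C j <= u.
pose S t := [set u | t <= u /\ idle u].
pose beta t := inf (S t).
(* Any time beyond [t] and all completion times is idle. *)
have Sne t : S t !=set0.
  exists (`|t| + \sum_a `|C a|); split.
    by rewrite (le_trans (ler_norm t))// lerDl sumr_ge0.
  move=> j _ _; rewrite (bigD1 j)//= addrCA; apply: le_trans (ler_norm _) _.
  by rewrite lerDl addr_ge0// sumr_ge0.
have Slb t u : S t u -> beta t <= u.
  by move=> Su; apply: ge_inf => //; exists t => v [].
have beta_ge t : t <= beta t by apply: lb_le_inf => // u [].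
have beta_homo : {homo beta : t u / t <= u}.
  move=> t u tu; apply: lb_le_inf => // v [uv iv]; apply: Slb.
  by split=> //; exact: le_trans uv.
have beta_idle t : idle t -> beta t = t.
  by move=> it; apply: le_anti; rewrite beta_ge Slb//; split.
have C_beta a t : J a -> release a <= t -> t <= C a -> C a <= beta t.
  move=> Ja rt tC; apply: lb_le_inf => // u [tu iu].
  by apply: iu => //; exact: le_trans tu.
have beta_same a t : J a -> release a <= t -> t <= C a ->
    beta t = beta (release a).
  move=> Ja rt tC; apply: le_anti; rewrite (beta_homo _ _ rt) andbT.
  (* An idle time after [release a] is at least [C a], hence at least [t]. *)
  apply: lb_le_inf => // u [ru iu]; apply: Slb; split=> //.
  exact: le_trans tC (iu _ Ja ru).
pose lam (a : job I) := G (beta (release a) - release a).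
pose gam t := G (beta t - t).
have gam0 t : 0 <= gam t by exact: G0.
have lam0 a : 0 <= lam a by exact: G0.
(* Measurability comes from monotonicity of both [G] and [beta]. *)
have mgam A : measurable A -> measurable_fun A gam.
  move=> mA; apply: (@measurableT_comp _ _ _ _ _ _ G).
    exact: nondecreasing_measurable.
  apply: measurable_funB => //.
  exact: nondecreasing_measurable.
have release_le_C a := release_le_completion a xC.
have lam_ge a : J a -> G (C a - release a) <= lam a.
  by move=> Ja; apply: Gh; rewrite lerD2r; exact: C_beta.
have dual_feasible a t : release a <= t -> lam a <= G (t - release a) + gam t.
  move=> rt; apply: le_trans (Gsub _ _); apply: Gh.
  by have := beta_homo _ _ rt; lra.
(* When [gam t > 0] some job [i] with [r_i <= t <= C_i] runs at rate 1, and
   [gam t <= lam i] because [beta t = beta r_i]. *)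
have gam_le t : gam t <= \sum_(a | J a) lam a * (x a t * \1_(`[release a, C a]) t).
  have term0 a : 0 <= lam a * (x a t * \1_(`[release a, C a]) t).
    by case: xs => _ x0 _ _; rewrite mulr_ge0 ?G0// mulr_ge0.
  have [it|/existsNP[j /not_implyP[Jj /not_implyP[rj /negP]]]] := pselect (idle t).
    by rewrite /gam beta_idle// subrr Gz sumr_ge0.
  rewrite -ltNge => tC; have [|i [Ji ri tCi xi]] := busy t; first by exists j.
  rewrite (bigD1 i)//= xi mul1r indicE mem_set/= ?in_itv/= ?ri// mulr1.
  rewrite -[leLHS]addr0 lerD ?sumr_ge0//.
  by apply: Gh; rewrite (beta_same i)// lerD2l lerN2.
pose Gam := (\int[lebesgue_measure]_t (gam t)%:E)%E.
pose L := \sum_(a | J a) proctime a * lam a.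
have [[mx x0 _ _] [my y0 _ ysum]] := (xs, ys).
(* Integrate [gam_le]: the rate of [a] over [[release a, C a]] integrates to [proctime a]. *)
have GamL : (Gam <= L%:E)%E.
  have mterm a := measurable_rate_indicator a (C a) xs measurableT.
  apply: (@le_trans _ _ (\int[lebesgue_measure]_t
      (\sum_(a <- [seq a <- index_enum (job I) | J a])
         (lam a)%:E * (x a t * \1_(`[release a, C a]) t)%:E)%E)%E).
    apply: ge0_le_integral => //.
    - by move=> t _; rewrite lee_fin.
    - by apply/measurable_EFinP; exact: mgam.
    - by apply: emeasurable_sum => a; apply: emeasurable_funM => //; exact: mterm.
    - move=> t _; under eq_bigr do rewrite -EFinM.
      by rewrite sumEFin lee_fin big_filter.
  have term0 a t : (0 <= (x a t * \1_(`[release a, C a]) t)%:E)%E.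
    by rewrite lee_fin mulr_ge0.
  rewrite ge0_integral_sum//; last 2 first.
  - by move=> a; apply: emeasurable_funM => //; exact: mterm.
  - by move=> a t _; rewrite mule_ge0// lee_fin.
  rewrite /L -sumEFin big_filter; apply: lee_sum => a Ja.
  rewrite ge0_integralZl_EFin//; last exact: mterm.
  by rewrite -work_indicator (xC a).1 mulrC EFinM.
(* Integrate [dual_feasible] against [y a] over [[release a, D a]], where [y a] has total mass
   [proctime a] and [t - release a] is at most the flow time; then extend the [gam] term to the
   whole line. *)
have feas a : ((proctime a * lam a)%:E <= (proctime a * G (D a - release a))%:E +
    \int[lebesgue_measure]_t (gam t * y a t)%:E)%E.
  have my' A k : measurable A -> measurable_fun A (fun t => (k * y a t)%:E).
    move=> mA; apply/measurable_EFinP; apply: measurable_funM => //.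
    exact: measurable_funS (my a).
  have mgy A : measurable A -> measurable_fun A (fun t => (gam t * y a t)%:E).
    move=> mA; apply/measurable_EFinP; apply: measurable_funM; first exact: mgam.
    exact: measurable_funS (my a).
  have intw k : 0 <= k -> (proctime a * k)%:E =
      (\int[lebesgue_measure]_(t in `[release a, D a]) (k * y a t)%:E)%E.
    move=> k0; rewrite mulrC EFinM; have [<- _] := yD a; rewrite /work.
    rewrite -ge0_integralZl_EFin//; first by move=> t _; rewrite lee_fin.
    by apply/measurable_EFinP; exact: measurable_funS (my a).
  rewrite !intw//.
  apply: (@le_trans _ _ (\int[lebesgue_measure]_(t in `[release a, D a])
    ((G (D a - release a) * y a t)%:E + (gam t * y a t)%:E))%E).
    apply: ge0_le_integral => //.
    - by move=> t _; rewrite lee_fin mulr_ge0.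
    - exact: my'.
    - by apply: emeasurable_funD; [exact: my'|exact: mgy].
    - move=> t /=; rewrite in_itv/= => /andP[rt tD].
      rewrite -EFinD lee_fin -mulrDl ler_wpM2r//.
      apply: le_trans (dual_feasible _ _ rt) _; rewrite lerD2r.
      by apply: Gh; rewrite lerD2r.
  rewrite ge0_integralD//; [|by move=> *; rewrite lee_fin mulr_ge0|exact: my'
    |by move=> *; rewrite lee_fin mulr_ge0|exact: mgy].
  rewrite leeD2l//; apply: ge0_subset_integral => //; first exact: mgy.
  by move=> *; rewrite lee_fin mulr_ge0.
(* At each time the rates of [y] on [J] add up to at most [s]. *)
have capacity : (\sum_(a | J a) \int[lebesgue_measure]_t (gam t * y a t)%:E <= s%:E * Gam)%E.
  have mgy a : measurable_fun setT (fun t => (gam t * y a t)%:E).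
    by apply/measurable_EFinP; apply: measurable_funM; [exact: mgam|exact: my].
  rewrite -big_filter -ge0_integral_sum//; last first.
    by move=> a t _; rewrite lee_fin mulr_ge0.
  rewrite -ge0_integralZl_EFin//; last 2 first.
  - by move=> t _; rewrite lee_fin.
  - by apply/measurable_EFinP; exact: mgam.
  apply: ge0_le_integral => //.
  - by move=> t _; rewrite sume_ge0// => a _; rewrite lee_fin mulr_ge0.
  - exact: emeasurable_sum.
  - by apply: emeasurable_funM => //; apply/measurable_EFinP; exact: mgam.
  move=> t _; rewrite sumEFin big_filter -EFinM lee_fin -mulr_sumr mulrC.
  rewrite ler_wpM2r//; apply: le_trans (ysum t).
  by rewrite [leRHS](bigID J)/= lerDl sumr_ge0.
have Lle : L <= \sum_(a | J a) proctime a * G (D a - release a) + s * L.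
  rewrite -lee_fin EFinD [in leLHS]/L -!sumEFin.
  apply: le_trans (lee_sum _ (fun a _ => feas a)) _.
  rewrite big_split/= leeD2l//; apply: le_trans capacity _.
  by rewrite EFinM lee_wpmul2l// lee_fin.
apply: le_trans (_ : (1 - s) * L <= _); last by lra.
rewrite ler_wpM2l ?subr_ge0//; apply: ler_sum => a Ja.
by rewrite ler_wpM2l ?lam_ge// ltW// proctime_gt0.
Qed.

(** * Completion of all jobs *)

(** Volume argument: a job unfinished at [T] would keep the machine at full rate on pending jobs
    throughout [[T0, T]], whose length [P + 1] exceeds the total processing time. *)
Lemma busy_completes (R : realType) (I : instance R) (x : rates I) :
  is_schedule 1 x ->
  (forall t, (exists j, pending x t j) -> exists i, pending x t i /\ x i t = 1) ->
  exists C, completion_times x C.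
Proof.
move=> xs busy; have [mx x0 _ _] := xs.
(* Release times are non-negative, so their sum [T0] is at or after each of them. *)
pose T0 := \sum_j release (i := I) j; pose P := \sum_j proctime (i := I) j.
pose T := T0 + P + 1.
have P0 : 0 <= P by rewrite sumr_ge0// => j _; rewrite ltW// proctime_gt0.
have T0T : T0 <= T by rewrite /T; lra.
suff completes j : ((proctime j)%:E <= work x j T)%E.
  have /choice[C xC] j := first_completion xs (completes j).
  by exists C => j; have [_ ->] := xC j.
rewrite leNgt; apply/negP => jT.
(* [c i] is the completion time of [i] if it finishes by [T], and [T] otherwise. *)
have /choice[c cP] i : exists c, (work x i c <= (proctime i)%:E)%E /\
    forall t, t <= T -> pending x t i -> t <= c.
  have [piT|Tpi] := leP (proctime i)%:E (work x i T).
    have [c [_ wc _]] := first_completion xs piT; exists c; rewrite wc; split=> //.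
    move=> t _ [_]; rewrite leNgt => wt; apply/negP => /ltW /(work_homo i xs).
    by rewrite wc leNgt wt.
  by exists T; split=> //; exact: ltW.
have mterm i A := @measurable_rate_indicator _ _ _ x i (c i) A xs.
have term0 i t : 0 <= x i t * \1_(`[release i, c i]) t by rewrite mulr_ge0.
suff : ((T - T0)%:E <= P%:E)%E by rewrite lee_fin /T; lra.
have -> : (T - T0)%:E = (\int[lebesgue_measure]_(t in `[T0, T]) (cst 1 t))%E.
  rewrite integral_cst//= lebesgue_measure_itv/= lte_fin mul1e.
  by case: ltP => // TT0; exfalso; move: TT0; rewrite /T; lra.
apply: (@le_trans _ _ (\int[lebesgue_measure]_(t in `[T0, T])
    (\sum_i (x i t * \1_(`[release i, c i]) t)%:E)%E)%E).
  apply: ge0_le_integral => //.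
    by apply: emeasurable_sum => i; exact: mterm.
  move=> t /=; rewrite in_itv/= => /andP[T0t tT].
  have [|i [it xi]] := busy t.
    exists j; split; last exact: le_lt_trans (work_homo j xs tT) jT.
    apply: le_trans T0t; rewrite /T0 (bigD1 j)//= lerDl sumr_ge0// => k _.
    exact: release_ge0.
  rewrite sumEFin lee_fin (bigD1 i)//= xi mul1r indicE mem_set.
    by rewrite lerDl sumr_ge0.
  by rewrite /= in_itv/= (cP i).2// andbT; case: it.
rewrite ge0_integral_sum//; last 2 first.
- by move=> i; exact: mterm.
- by move=> i t _; rewrite lee_fin.
rewrite -sumEFin; apply: lee_sum => i _; apply: le_trans (cP i).1.
rewrite work_indicator; apply: ge0_subset_integral => //; first exact: mterm.
by move=> t _; rewrite lee_fin.
Qed.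

(** * Competitiveness of HDF *)

Theorem theorem21 (R : realType) (g : R -> R)
  (g_ge0 : forall u : R, 0 <= u -> 0 <= g u)
  (g_concave : concave_function `[0, +oo[ g)
  (g_nondecreasing : {in `[0, +oo[ &, nondecreasing_fun g})
  (g0 : g 0 = 0)
  (A : algorithm R) (A_HDF : is_HDF A)
  (epsilon : R) (epsilon_gt0 : 0 < epsilon) :
  competitive g A (1 + epsilon) ((1 + epsilon) / epsilon).
Proof.
move=> I; have [xs hdf] := A_HDF I; split=> //; set x := A I in xs hdf *.
have [|C xC] := busy_completes xs.
  by move=> t /hdf[i [it _ xi]]; exists i.
exists C; split=> //; set s := (1 + epsilon)^-1.
have e1 : 0 < 1 + epsilon by rewrite addr_gt0.
have s0 : 0 <= s by rewrite invr_ge0 ltW.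
have s1 : s <= 1 by rewrite invf_le1// lerDl ltW.
have sE : 1 - s = ((1 + epsilon) / epsilon)^-1.
  by rewrite /s; field; rewrite !gt_eqF.
have b0 : 0 < (1 + epsilon) / epsilon by rewrite divr_gt0.
(* Extending [g] by 0 to negative arguments makes it monotone and subadditive on the whole line. *)
pose G u := g (Num.max u 0).
have G0 u : 0 <= G u by apply: g_ge0; rewrite le_max lexx orbT.
have max0 (u : R) : Num.max u 0 \in `[0, +oo[.
  by rewrite in_itv/= andbT le_max lexx orbT.
have Gh : {homo G : u v / u <= v}.
  move=> u v uv; apply: g_nondecreasing; [exact: max0|exact: max0|].
  by rewrite ge_max !le_max uv lexx orbT.
have Gsub u v : G (u + v) <= G u + G v.
  apply: le_trans (concave_subadditive g_concave g0 _ _).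
  - apply: g_nondecreasing; [exact: max0| |].
      by rewrite in_itv/= andbT addr_ge0// le_max lexx orbT.
    by rewrite ge_max lerD ?addr_ge0 ?le_max ?lexx ?orbT.
  - by rewrite le_max lexx orbT.
  - by rewrite le_max lexx orbT.
have Gz : G 0 = 0 by rewrite /G maxxx.
have GE u : 0 <= u -> G u = g u by move=> u0; rewrite /G max_l.
suff opt (y : rates I) (D : job I -> R) : is_schedule s y -> completion_times y D ->
    (1 - s) * cost g C <= cost g D.
  apply: (@le_trans _ _ (((1 + epsilon) / epsilon)%:E * ((1 - s) * cost g C)%:E)%E).
    by rewrite -EFinM lee_fin mulrA sE divff ?mul1r// gt_eqF.
  rewrite lee_pmul2l// ?lte_fin//; apply: le_ereal_inf_tmp => _ [y [D [ys yD ->]]].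
  by rewrite lee_fin (opt y).
move=> ys yD; rewrite -subr_ge0.
(* Since [weight a] is [density a * proctime a], the gap between the costs is the density-weighted
   sum of the [c a]. *)
pose c (a : job I) := proctime a * G (D a - release a) -
  (1 - s) * (proctime a * G (C a - release a)).
have -> : cost g D - (1 - s) * cost g C = \sum_a density a * c a.
  rewrite /cost mulr_sumr -sumrB; apply: eq_bigr => a _.
  rewrite /c !GE ?subr_ge0 ?(release_le_completion a xC) ?(release_le_completion a yD)//.
  by rewrite /density; field; rewrite gt_eqF ?proctime_gt0.
apply: threshold_sum_ge0 => [a|th _].
  by rewrite divr_ge0// ltW// ?weight_gt0 ?proctime_gt0.
rewrite sumrB -mulr_sumr subr_ge0.
(* When a job of density at least [th] is pending, the densest pending job, which HDF runs, also has
   density at least [th]. *)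
apply: (work_conserving_bound xs xC ys yD) => // t [j [jth rj tj]].
have [|i [it imax xi]] := hdf t.
  by exists j; apply/(pending_completionP _ _ xs xC); rewrite rj.
have /andP[ri ti] := (pending_completionP _ _ xs xC).1 it.
exists i; split=> //; last exact: ltW.
by apply: le_trans jth (imax _ _); apply/(pending_completionP _ _ xs xC); rewrite rj.
Qed.
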